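(* For two states $L,R$ of the ideal MHD system, let $\widehat{\mathcal H}$ be the $8\times8$ matrix (all averages taken between $L$ and $R$) $$\widehat{\mathcal H}=\begin{bmatrix} \rho^{\ln}&\rho^{\ln}\{\!\{u\}\!\}&\rho^{\ln}\{\!\{v\}\!\}&\rho^{\ln}\{\!\{w\}\!\}&\overline E&0&0&0\\ \rho^{\ln}\{\!\{u\}\!\}&\rho^{\ln}\{\!\{u\}\!\}^2+\tilde p&\rho^{\ln}\{\!\{u\}\!\}\{\!\{v\}\!\}&\rho^{\ln}\{\!\{u\}\!\}\{\!\{w\}\!\}&(\overline E+\tilde p)\{\!\{u\}\!\}&0&0&0\\ \rho^{\ln}\{\!\{v\}\!\}&\rho^{\ln}\{\!\{v\}\!\}\{\!\{u\}\!\}&\rho^{\ln}\{\!\{v\}\!\}^2+\tilde p&\rho^{\ln}\{\!\{v\}\!\}\{\!\{w\}\!\}&(\overline E+\tilde p)\{\!\{v\}\!\}&0&0&0\\ \rho^{\ln}\{\!\{w\}\!\}&\rho^{\ln}\{\!\{w\}\!\}\{\!\{u\}\!\}&\rho^{\ln}\{\!\{w\}\!\}\{\!\{v\}\!\}&\rho^{\ln}\{\!\{w\}\!\}^2+\tilde p&(\overline E+\tilde p)\{\!\{w\}\!\}&0&0&0\\ \overline E&(\overline E+\tilde p)\{\!\{u\}\!\}&(\overline E+\tilde p)\{\!\{v\}\!\}&(\overline E+\tilde p)\{\!\{w\}\!\}&\widehat{\mathcal H}_{5,5}&\tau\{\!\{B_1\}\!\}&\tau\{\!\{B_2\}\!\}&\tau\{\!\{B_3\}\!\}\\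 0&0&0&0&\tau\{\!\{B_1\}\!\}&\tau&0&0\\ 0&0&0&0&\tau\{\!\{B_2\}\!\}&0&\tau&0\\ 0&0&0&0&\tau\{\!\{B_3\}\!\}&0&0&\tau \end{bmatrix}$$ with $$\widehat{\mathcal H}_{5,5}=\frac1{\rho^{\ln}}\Big(\frac{(p^{\ln})^2}{\gamma-1}+\overline E^2\Big)+\tilde p\big(\{\!\{u\}\!\}^2+\{\!\{v\}\!\}^2+\{\!\{w\}\!\}^2\big)+\tau\sum_{i=1}^3\{\!\{B_i\}\!\}^2,\qquad \tilde p=\frac{\{\!\{\rho\}\!\}}{2\{\!\{\beta\}\!\}},\qquad \tau=\frac{\tilde p}{\{\!\{\rho\}\!\}} .$$ Then the jumps of the conserved variables $q$ and the entropy variables $v$ satisfy $$([\![q]\!])_i=(\widehat{\mathcal H}[\![v]\!])_i\quad\text{for } i\in\{1,2,3,4,6,7,8\},$$ and in the total energy component equality holds asymptotically, $([\![q]\!])_5\simeq(\widehat{\mathcal H}[\![v]\!])_5$, i.e. $([\![q]\!])_5-(\widehat{\mathcal H}[\![v]\!])_5=o(\|[\![q]\!]\|)$ as the states $q_L,q_R$ tend to a common admissible state.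
   Context: A state is given by density $\rho>0$, velocity $\vec u=(u,v,w)$, pressure $p>0$ and magnetic field $\vec B=(B_1,B_2,B_3)$; $\gamma>1$ is constant. Conserved variables: $q=(\rho,\rho u,\rho v,\rho w,E,B_1,B_2,B_3)^T$ with $E=\frac{p}{\gamma-1}+\frac\rho2\|\vec u\|^2+\frac12\|\vec B\|^2$. Let $\beta=\frac{\rho}{2p}$, $s=\ln p-\gamma\ln\rho$. Entropy variables: $v=\big(\frac{\gamma-s}{\gamma-1}-\beta\|\vec u\|^2,\ 2\beta u,\ 2\beta v,\ 2\beta w,\ -2\beta,\ 2\beta B_1,\ 2\beta B_2,\ 2\beta B_3\big)^T$. For two states $L,R$: $[\![a]\!]=a_R-a_L$, $\{\!\{a\}\!\}=\frac12(a_L+a_R)$, and for positive $a$ the logarithmic mean is $a^{\ln}=\frac{a_L-a_R}{\ln a_L-\ln a_R}$ (the common value if $a_L=a_R$), used for $\rho^{\ln}$ and $\beta^{\ln}$. Further $$p^{\ln}:=\frac{\rho^{\ln}}{2\beta^{\ln}},\qquad \overline{\|\vec u\|^2}:=2\big(\{\!\{u\}\!\}^2+\{\!\{v\}\!\}^2+\{\!\{w\}\!\}^2\big)-\big(\{\!\{u^2\}\!\}+\{\!\{v^2\}\!\}+\{\!\{w^2\}\!\}\big),\qquad \overline E:=\frac{p^{\ln}}{\gamma-1}+\frac12\rho^{\ln}\,\overline{\|\vec u\|^2}.$$ *)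

(* Defs.v *)
From HB Require Import structures.
From mathcomp Require Import all_boot all_order all_algebra.
From mathcomp Require Import all_classical all_reals all_analysis.
Set Implicit Arguments.
Unset Strict Implicit.
Unset Printing Implicit Defensive.
Import Order.TTheory GRing.Theory Num.Theory.
Import numFieldNormedType.Exports.
Local Open Scope classical_set_scope.
Local Open Scope ring_scope.

Record state (R : realType) := State {
  rho : R;
  u : R;
  v : R;
  w : R;
  p : R;
  B1 : R;
  B2 : R;
  B3 : R;
  rho_gt0 : 0 < rho;
  p_gt0 : 0 < p
}.

Arguments rho {R} _.
Arguments u {R} _.
Arguments v {R} _.
Arguments w {R} _.
Arguments p {R} _.
Arguments B1 {R} _.
Arguments B2 {R} _.
Arguments B3 {R} _.

Definition col8 (R : realType) (s : seq R) : 'cV[R]_8 := \col_(i < 8) nth 0 s i.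

Definition mx8 (R : realType) (rows : seq (seq R)) : 'M[R]_8 :=
  \matrix_(i < 8, j < 8) nth 0 (nth [::] rows i) j.

Section MHD.
Variable R : realType.
Implicit Types S L Rt : state R.

Definition normu2 S : R := u S ^+ 2 + v S ^+ 2 + w S ^+ 2.
Definition normB2 S : R := B1 S ^+ 2 + B2 S ^+ 2 + B3 S ^+ 2.

Definition energy (gamma : R) S : R :=
  p S / (gamma - 1) + rho S / 2 * normu2 S + 1 / 2 * normB2 S.

Definition conserved (gamma : R) S : 'cV[R]_8 :=
  col8 [:: rho S; rho S * u S; rho S * v S; rho S * w S;
           energy gamma S; B1 S; B2 S; B3 S].

Definition beta S : R := rho S / (2 * p S).

Definition entropy (gamma : R) S : R := ln (p S) - gamma * ln (rho S).

Definition entropy_vars (gamma : R) S : 'cV[R]_8 :=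
  col8 [:: (gamma - entropy gamma S) / (gamma - 1) - beta S * normu2 S;
           2 * beta S * u S; 2 * beta S * v S; 2 * beta S * w S;
           - (2 * beta S);
           2 * beta S * B1 S; 2 * beta S * B2 S; 2 * beta S * B3 S].

Definition jump (V : zmodType) (a : state R -> V) L Rt : V := a Rt - a L.

Definition avg (a : state R -> R) L Rt : R := 1 / 2 * (a L + a Rt).

Definition logmean (a : state R -> R) L Rt : R :=
  if a L == a Rt then a L else (a L - a Rt) / (ln (a L) - ln (a Rt)).

Definition p_ln L Rt : R := logmean rho L Rt / (2 * logmean beta L Rt).

Definition u2_bar L Rt : R :=
  2 * (avg u L Rt ^+ 2 + avg v L Rt ^+ 2 + avg w L Rt ^+ 2)
  - (avg (fun S => u S ^+ 2) L Rt + avg (fun S => v S ^+ 2) L Rt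
     + avg (fun S => w S ^+ 2) L Rt).

Definition E_bar (gamma : R) L Rt : R :=
  p_ln L Rt / (gamma - 1) + 1 / 2 * logmean rho L Rt * u2_bar L Rt.

Definition p_tilde L Rt : R := avg rho L Rt / (2 * avg beta L Rt).

Definition tau L Rt : R := p_tilde L Rt / avg rho L Rt.

Definition H55 (gamma : R) L Rt : R :=
  1 / logmean rho L Rt * (p_ln L Rt ^+ 2 / (gamma - 1) + E_bar gamma L Rt ^+ 2)
  + p_tilde L Rt * (avg u L Rt ^+ 2 + avg v L Rt ^+ 2 + avg w L Rt ^+ 2)
  + tau L Rt * (avg B1 L Rt ^+ 2 + avg B2 L Rt ^+ 2 + avg B3 L Rt ^+ 2).

Definition H_hat (gamma : R) L Rt : 'M[R]_8 :=
  let r := logmean rho L Rt in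
  let a := avg u L Rt in
  let b := avg v L Rt in
  let c := avg w L Rt in
  let E := E_bar gamma L Rt in
  let P := p_tilde L Rt in
  let t := tau L Rt in
  let b1 := avg B1 L Rt in
  let b2 := avg B2 L Rt in
  let b3 := avg B3 L Rt in
  mx8
  [:: [:: r;     r * a;          r * b;          r * c;          E;                0;      0;      0];
      [:: r * a; r * a ^+ 2 + P; r * a * b;      r * a * c;      (E + P) * a;      0;      0;      0];
      [:: r * b; r * b * a;      r * b ^+ 2 + P; r * b * c;      (E + P) * b;      0;      0;      0];
      [:: r * c; r * c * a;      r * c * b;      r * c ^+ 2 + P; (E + P) * c;      0;      0;      0];
      [:: E;     (E + P) * a;    (E + P) * b;    (E + P) * c;    H55 gamma L Rt;   t * b1; t * b2; t * b3];
      [:: 0;     0;              0;              0;              t * b1;           t;      0;      0];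
      [:: 0;     0;              0;              0;              t * b2;           0;      t;      0];
      [:: 0;     0;              0;              0;              t * b3;           0;      0;      t]].

(* Indices are counted from 0: the fifth component has index 4. *)
Definition energy_index : 'I_8 := inord 4.

(* The filter on pairs of states (L, Rt) for the limit in which the conserved
   vectors of L and Rt both tend to that of S0. *)
Definition tends_to_common (gamma : R) (S0 : state R) :
    set_system (state R * state R) :=
  filter_from [set d : R | 0 < d]
    (fun d => [set LR | ball (conserved gamma S0) d (conserved gamma LR.1) /\
                        ball (conserved gamma S0) d (conserved gamma LR.2)]).

#[global] Instance tends_to_common_filter (gamma : R) (S0 : state R) :
  ProperFilter (tends_to_common gamma S0).
Proof.
apply: filter_from_proper; last first.
  by move=> d /= d0; exists (S0, S0); split; exact: ballxx.
apply: filter_from_filter; first by exists 1; exact: ltr01.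
move=> d e d0 e0; exists (Num.min d e); first by rewrite /= lt_min d0 e0.
move=> LR [hL hR]; split; split.
- by apply: le_ball hL; rewrite ge_min lexx.
- by apply: le_ball hR; rewrite ge_min lexx.
- by apply: le_ball hL; rewrite ge_min lexx orbT.
- by apply: le_ball hR; rewrite ge_min lexx orbT.
Qed.

Canonical tends_to_common_filter_on (gamma : R) (S0 : state R) :=
  FilterType (tends_to_common gamma S0) _.

End MHD.

(* Main.v *)
Require Import Defs.
From HB Require Import structures.
From mathcomp Require Import all_boot all_order all_algebra.
From mathcomp Require Import all_classical all_reals all_analysis.
From mathcomp Require Import ring.
Import Order.TTheory GRing.Theory Num.Theory.
Import numFieldNormedType.Exports.
Local Open Scope classical_set_scope.
Local Open Scope ring_scope.

(** Write [a] for the jump and {a} for the average of a quantity, and r, b for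
    the logarithmic means of rho and beta. Two rules turn the jump of every
    entropy variable into jumps of rho, beta, u, v, w and B: the product rule
    [fg] = {f}[g] + {g}[f], and [ln a] = [a] / a^ln, which is what the
    logarithmic mean is made for. As p = rho / (2 beta), the physical entropy is
    a combination of ln rho and ln beta, so the first entropy variable obeys

      [v_1] = [rho]/r + [beta]/(b (gamma - 1)) - [beta |u|^2].

    Three building blocks follow. The density row of the matrix gives [rho]
    ([density_row]): the averages E_bar and u2_bar are exactly what cancels the
    terms in [beta]. For every quantity f, the combination
    [2 beta f] - {f}[2 beta] equals 2 {beta}[f], so tau times it is [f] and
    p_tilde times it is {rho}[f] ([tau_beta_jump], [p_tilde_beta_jump]). A
    momentum row is {u} times the density row plus the second block, hence
    {u}[rho] + {rho}[u] = [rho u]; a magnetic row is the first block.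

    The energy row reduces to the same blocks, but its defect does not vanish:
    it is c_rho [rho] + c_beta [beta] ([energy_defect]), where both coefficients
    compare different means of the same quantities and therefore tend to 0 when
    the two states merge. It remains to see that [rho] and [beta] are
    O(||[q]||). This is a Lipschitz property: the functions of the state that
    are Lipschitz in q near the common limit contain the components of q and are
    closed under sums, products and inverses, hence contain the velocity, the
    pressure and beta. Such functions also converge along the limit, and their
    logarithmic means converge too, being squeezed between the values at the two
    states. *)

(** * The logarithmic mean *)

Section LogMean.
Context {R : realType}.
Implicit Types (a : state R -> R) (L Rt : state R).

Lemma ln_sub_le (x y : R) : 0 < x -> 0 < y -> ln x - ln y <= (x - y) / y.
Proof.
move=> x0 y0; rewrite -ln_div// mulrBl divff ?gt_eqF//.
rewrite -{1}[x / y](subrKC 1); apply: le_ln1Dx.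
by rewrite ltrBrDr addNr divr_gt0.
Qed.

Lemma ln_jump a L Rt : 0 < a L -> 0 < a Rt ->
  ln (a Rt) - ln (a L) = (a Rt - a L) / logmean a L Rt.
Proof.
move=> aL aR; rewrite /logmean; case: eqVneq => [->|ne]; first by rewrite !subrr mul0r.
have d : ln (a L) - ln (a Rt) != 0.
  by rewrite subr_eq0; apply: contra_neq ne => /ln_inj; apply.
have e : a L - a Rt != 0 by rewrite subr_eq0.
by field; rewrite d e.
Qed.

(** The reciprocal of the logarithmic mean is the slope of a chord of ln, and the
    tangent bound [ln_sub_le], used at both end points, puts that slope between
    1/x and 1/y. *)
Lemma logmean_between a L Rt : 0 < a L -> 0 < a Rt ->
  Num.min (a L) (a Rt) <= logmean a L Rt <= Num.max (a L) (a Rt).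
Proof.
rewrite /logmean; move: (a L) (a Rt) => x y x0 y0.
wlog: x y x0 y0 / x < y => [H|xy].
  case: eqVneq => [->|ne]; first by rewrite ge_min le_max lexx.
  case/lt_total/orP: (ne) => [xy|yx].
    by have := H _ _ x0 y0 xy; rewrite (negPf ne).
  rewrite minC maxC; have := H _ _ y0 x0 yx; rewrite eq_sym (negPf ne).
  by rewrite -[y - x]opprB -[ln y - ln x]opprB invrN mulrNN.
rewrite lt_eqF// min_l ?max_r ?(ltW xy)//.
have d : 0 < ln y - ln x by rewrite subr_gt0 ltr_ln.
rewrite -[x - y]opprB -[ln x - ln y]opprB invrN mulrNN.
have h1 := ln_sub_le _ _ y0 x0; have h2 := ln_sub_le _ _ x0 y0.
rewrite ler_pdivlMr// ler_pdivrMr// -ler_pdivlMl// mulrC h1/=.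
rewrite -ler_pdivrMl// mulrC.
by rewrite -lerN2 opprB -mulNr opprB.
Qed.

Lemma logmean_gt0 a L Rt : 0 < a L -> 0 < a Rt -> 0 < logmean a L Rt.
Proof.
move=> aL aR; have /andP[h _] := logmean_between a L Rt aL aR.
by apply: lt_le_trans h; rewrite lt_min aL.
Qed.

End LogMean.

(** * The rows of the matrix *)

Section Rows.
Context {R : realType} {gamma : R} (hgamma : 1 < gamma).
Implicit Types (L Rt S : state R).

Lemma beta_gt0 S : 0 < beta S.
Proof. by rewrite divr_gt0 ?mulr_gt0 ?rho_gt0 ?p_gt0. Qed.

Lemma pE S : p S = rho S / (2 * beta S).
Proof.
have := rho_gt0 S; have := p_gt0 S => /lt0r_neq0 ? /lt0r_neq0 ?.
by rewrite /beta; field; apply/andP.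
Qed.

Lemma entropyE S : entropy gamma S = - (gamma - 1) * ln (rho S) - ln (beta S) - ln 2.
Proof.
have b0 := beta_gt0 S; have b2 : 0 < 2 * beta S by rewrite pmulr_rgt0.
by rewrite /entropy pE ln_div ?(@lnM _ 2) ?posrE ?rho_gt0//; ring.
Qed.

Definition entropy_var0 (S : state R) : R :=
  (gamma - entropy gamma S) / (gamma - 1) - beta S * normu2 S.

Lemma gamma_sub1_neq0 : gamma - 1 != 0.
Proof. by rewrite subr_eq0 gt_eqF. Qed.

Lemma entropy_var0_jump L Rt :
  jump entropy_var0 L Rt =
  jump (@rho R) L Rt / logmean (@rho R) L Rt
  + jump (@beta R) L Rt / logmean (@beta R) L Rt / (gamma - 1)
  - jump (fun S => beta S * normu2 S) L Rt.
Proof.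
have g := gamma_sub1_neq0.
rewrite /entropy_var0 /jump -!ln_jump ?rho_gt0 ?beta_gt0// !entropyE.
by field.
Qed.

(** Summed over the velocity components, 2 {u}[beta u] - [beta u^2] collapses to
    (2 {u}^2 - {u^2}) [beta]; this adds up to u2_bar [beta]. The term
    - 2 E_bar [beta] cancels it, and with it the ln beta part of [v_1], whose
    coefficient r / (b (gamma - 1)) is 2 p_ln / (gamma - 1). *)
Lemma density_row L Rt :
  logmean (@rho R) L Rt *
    (jump entropy_var0 L Rt
     + avg (@u R) L Rt * jump (fun S => 2 * beta S * u S) L Rt
     + avg (@v R) L Rt * jump (fun S => 2 * beta S * v S) L Rt
     + avg (@w R) L Rt * jump (fun S => 2 * beta S * w S) L Rt)
  + E_bar gamma L Rt * jump (fun S => - (2 * beta S)) L Rt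
  = jump (@rho R) L Rt.
Proof.
have g := gamma_sub1_neq0.
rewrite entropy_var0_jump /jump /E_bar /p_ln /u2_bar /normu2 /avg.
have := logmean_gt0 _ L Rt (beta_gt0 L) (beta_gt0 Rt).
have := logmean_gt0 _ L Rt (rho_gt0 L) (rho_gt0 Rt).
move: (logmean _ _ _) (logmean _ _ _) => r b /lt0r_neq0 r0 /lt0r_neq0 b0.
move: (beta L) (beta Rt) => bL bR.
by field; rewrite g r0 b0.
Qed.

Lemma avg_gt0 (f : state R -> R) L Rt : 0 < f L -> 0 < f Rt -> 0 < avg f L Rt.
Proof. by move=> fL fR; rewrite /avg mulr_gt0 ?addr_gt0 ?divr_gt0. Qed.

Lemma tauE L Rt : tau L Rt = (2 * avg (@beta R) L Rt)^-1.
Proof.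
have /lt0r_neq0 r0 := avg_gt0 _ L Rt (rho_gt0 L) (rho_gt0 Rt).
have /lt0r_neq0 b0 := avg_gt0 _ L Rt (beta_gt0 L) (beta_gt0 Rt).
by rewrite /tau /p_tilde; field; rewrite r0 b0.
Qed.

(** By the product rule the bracket is 2 {beta}[f], and tau = 1 / (2 {beta}). *)
Lemma tau_beta_jump (f : state R -> R) L Rt :
  tau L Rt * (jump (fun S => 2 * beta S * f S) L Rt
              + avg f L Rt * jump (fun S => - (2 * beta S)) L Rt)
  = jump f L Rt.
Proof.
have /lt0r_neq0 := avg_gt0 _ L Rt (beta_gt0 L) (beta_gt0 Rt).
rewrite tauE /jump /avg; move: (beta L) (beta Rt) => bL bR b0.
have b1 : bL + bR != 0 by apply: contraNneq b0 => ->; rewrite mulr0.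
by field.
Qed.

Lemma p_tilde_beta_jump (f : state R -> R) L Rt :
  p_tilde L Rt * (jump (fun S => 2 * beta S * f S) L Rt
              + avg f L Rt * jump (fun S => - (2 * beta S)) L Rt)
  = avg (@rho R) L Rt * jump f L Rt.
Proof.
have /lt0r_neq0 r0 := avg_gt0 _ L Rt (rho_gt0 L) (rho_gt0 Rt).
by rewrite -[in RHS]tau_beta_jump mulrA /tau mulrCA divff// mulr1.
Qed.

Lemma jump_mul (f g : state R -> R) L Rt :
  jump (fun S => f S * g S) L Rt
  = avg f L Rt * jump g L Rt + avg g L Rt * jump f L Rt.
Proof. by rewrite /jump /avg; field. Qed.

Lemma mx8_mul_col8 rows (s : seq R) i :
  (mx8 rows *m col8 s) i 0 =
  let a := nth [::] rows i in
  a`_0 * s`_0 + a`_1 * s`_1 + a`_2 * s`_2 + a`_3 * s`_3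
  + a`_4 * s`_4 + a`_5 * s`_5 + a`_6 * s`_6 + a`_7 * s`_7.
Proof. by rewrite !mxE !big_ord_recl big_ord0 !mxE /= addr0 !addrA. Qed.

Lemma jump_entropy_vars L Rt :
  jump (entropy_vars gamma) L Rt =
  col8 [:: jump entropy_var0 L Rt;
           jump (fun S => 2 * beta S * u S) L Rt;
           jump (fun S => 2 * beta S * v S) L Rt;
           jump (fun S => 2 * beta S * w S) L Rt;
           jump (fun S => - (2 * beta S)) L Rt;
           jump (fun S => 2 * beta S * B1 S) L Rt;
           jump (fun S => 2 * beta S * B2 S) L Rt;
           jump (fun S => 2 * beta S * B3 S) L Rt].
Proof. by apply/colP => -[[|[|[|[|[|[|[|[|i]]]]]]]] lti] //; rewrite /jump !mxE. Qed.

Lemma jump_conserved L Rt :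
  jump (conserved gamma) L Rt =
  col8 [:: jump (@rho R) L Rt;
           jump (fun S => rho S * u S) L Rt;
           jump (fun S => rho S * v S) L Rt;
           jump (fun S => rho S * w S) L Rt;
           jump (energy gamma) L Rt;
           jump (@B1 R) L Rt; jump (@B2 R) L Rt; jump (@B3 R) L Rt].
Proof. by apply/colP => -[[|[|[|[|[|[|[|[|i]]]]]]]] lti] //; rewrite /jump !mxE. Qed.

Lemma jump_conserved_exact L Rt (i : 'I_8) : i != energy_index ->
  jump (conserved gamma) L Rt i 0 =
  (H_hat gamma L Rt *m jump (entropy_vars gamma) L Rt) i 0.
Proof.
move=> i4; rewrite jump_conserved jump_entropy_vars mx8_mul_col8 mxE.
have := fun f => p_tilde_beta_jump f L Rt.
have := fun f => tau_beta_jump f L Rt.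
have := density_row L Rt.
set r := logmean _ _ _; set P := p_tilde _ _; set t := tau _ _.
set E := E_bar _ _ _.
set x4 := jump (fun S => - (2 * beta S)) L Rt; set x0 := jump entropy_var0 _ _.
move=> dens tauJ PJ.
case: i i4 => -[|[|[|[|[|[|[|[|i]]]]]]]] lti //= i4.
- by rewrite -dens; ring.
- by rewrite jump_mul -PJ -dens; ring.
- by rewrite jump_mul -PJ -dens; ring.
- by rewrite jump_mul -PJ -dens; ring.
- by case/eqP: i4; apply: val_inj; rewrite /= inordK.
- by rewrite -tauJ; ring.
- by rewrite -tauJ; ring.
- by rewrite -tauJ; ring.
Qed.

Lemma jump_energy L Rt :
  jump (energy gamma) L Rt =
  jump (@p R) L Rt / (gamma - 1) +
  2^-1 * (avg (@rho R) L Rt * jump (@normu2 R) L Rt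
         + avg (@normu2 R) L Rt * jump (@rho R) L Rt)
  + 2^-1 * jump (@normB2 R) L Rt.
Proof.
by rewrite /jump /energy /avg; field; exact: gamma_sub1_neq0.
Qed.

(** The coefficients of [rho] and [beta] in the energy defect. The exact jump of
    p = rho / (2 beta) is {1/(2 beta)}[rho] - {rho}[beta] / (2 beta_L beta_R),
    whereas the matrix yields [rho] / (2 b) - r [beta] / (2 b^2). *)
Definition defect_rho (LR : state R * state R) : R :=
  (gamma - 1)^-1 * (avg (fun S => (2 * beta S)^-1) LR.1 LR.2
                    - (2 * logmean (@beta R) LR.1 LR.2)^-1)
  + 4^-1 * (jump (@u R) LR.1 LR.2 ^+ 2 + jump (@v R) LR.1 LR.2 ^+ 2
            + jump (@w R) LR.1 LR.2 ^+ 2).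

Definition defect_beta (LR : state R * state R) : R :=
  (gamma - 1)^-1 *
  (logmean (@rho R) LR.1 LR.2 / (2 * logmean (@beta R) LR.1 LR.2 ^+ 2)
   - avg (@rho R) LR.1 LR.2 / (2 * (beta LR.1 * beta LR.2))).

(** The magnetic part of the energy jump is reproduced exactly. The kinetic part
    is off by [rho]/2 times {|u|^2} - u2_bar = ([u]^2 + [v]^2 + [w]^2) / 2, and
    the internal part by [p] - [rho] / (2 b) + r [beta] / (2 b^2), divided by
    gamma - 1. *)
Lemma energy_defect L Rt :
  jump (conserved gamma) L Rt energy_index 0
  - (H_hat gamma L Rt *m jump (entropy_vars gamma) L Rt) energy_index 0
  = defect_rho (L, Rt) * jump (@rho R) L Rt
    + defect_beta (L, Rt) * jump (@beta R) L Rt.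
Proof.
rewrite jump_conserved jump_entropy_vars mx8_mul_col8 mxE /energy_index inordK//.
rewrite [nth _ _ _]/=.
have g := gamma_sub1_neq0.
have := fun f => p_tilde_beta_jump f L Rt.
have := fun f => tau_beta_jump f L Rt.
have := density_row L Rt.
have := logmean_gt0 _ L Rt (beta_gt0 L) (beta_gt0 Rt).
have := logmean_gt0 _ L Rt (rho_gt0 L) (rho_gt0 Rt).
move=> /lt0r_neq0 r0 /lt0r_neq0 b0 dens tauJ PJ.
(* The energy row, as E_bar / r times the density row plus {u} and {B} times the
   tau and p_tilde combinations; the squares of E_bar in H55 are used up here. *)
transitivity (jump (energy gamma) L Rt - (
   E_bar gamma L Rt / logmean (@rho R) L Rt * jump (@rho R) L Rt
   + p_ln L Rt ^+ 2 / (gamma - 1) / logmean (@rho R) L Rt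
     * jump (fun S => - (2 * beta S)) L Rt
   + (avg (@u R) L Rt * (avg (@rho R) L Rt * jump (@u R) L Rt)
      + avg (@v R) L Rt * (avg (@rho R) L Rt * jump (@v R) L Rt)
      + avg (@w R) L Rt * (avg (@rho R) L Rt * jump (@w R) L Rt))
   + (avg (@B1 R) L Rt * jump (@B1 R) L Rt
      + avg (@B2 R) L Rt * jump (@B2 R) L Rt
      + avg (@B3 R) L Rt * jump (@B3 R) L Rt))).
  congr (_ - _); rewrite -!PJ -(tauJ (@B1 R)) -(tauJ (@B2 R))
    -(tauJ (@B3 R)) -dens /H55 /=.
  (* All jumps become variables: unfolded, they make the identity too large for
     field. *)
  move: (E_bar _ _ _) (p_ln _ _) (p_tilde _ _) (tau _ _) => E pl P t.
  move: (logmean rho L Rt) r0 => r r0.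
  move: (jump entropy_var0 L Rt) (jump (fun S => - (2 * beta S)) L Rt).
  move: (jump (fun S => 2 * beta S * u S) L Rt) (avg u L Rt).
  move: (jump (fun S => 2 * beta S * v S) L Rt) (avg v L Rt).
  move: (jump (fun S => 2 * beta S * w S) L Rt) (avg w L Rt).
  move: (jump (fun S => 2 * beta S * B1 S) L Rt) (avg B1 L Rt).
  move: (jump (fun S => 2 * beta S * B2 S) L Rt) (avg B2 L Rt).
  move: (jump (fun S => 2 * beta S * B3 S) L Rt) (avg B3 L Rt).
  move=> y3 b3 y2 b2 y1 b1 x3 c x2 b x1 a x0 x4.
  by field; rewrite r0 g.
rewrite /defect_rho /defect_beta /= jump_energy /E_bar /p_ln /u2_bar.
rewrite /normu2 /normB2 /jump /avg !pE.
move: (logmean rho L Rt) (logmean (@beta R) L Rt) r0 b0 => r b r0 b0.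
have /lt0r_neq0 := beta_gt0 L; have /lt0r_neq0 := beta_gt0 Rt.
move: (beta L) (beta Rt) => bL bR bR0 bL0.
by field; rewrite g r0 b0 bL0 bR0.
Qed.

End Rows.

(** * Functions that are Lipschitz in the conserved variables *)

Lemma le_coord_norm {R : realType} {m n : nat} (x : 'M[R]_(m, n)) i j :
  `|x i j| <= `|x|.
Proof.
rewrite [leRHS]/Num.norm/= mx_normrE.
exact: (le_bigmax _ (fun ij : 'I_m * 'I_n => `|x ij.1 ij.2|) (i, j)).
Qed.

Section Lipschitz.
Context {R : realType} {gamma : R} (hgamma : 1 < gamma) (S0 : state R).
Implicit Types (L Rt S : state R) (f g : state R -> R).
Let F := tends_to_common gamma S0.
Let dq (LR : state R * state R) := jump (conserved gamma) LR.1 LR.2.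

(** Local Lipschitz continuity at S0 of f as a function of the conserved vector.
    Stating it for pairs of states, rather than against S0 alone, is what makes
    [f] usable as a factor of the size of [q]. *)
Definition lipschitz f :=
  (fun LR => jump f LR.1 LR.2) =O_ (tends_to_common gamma S0)
  (fun LR : state R * state R => jump (conserved gamma) LR.1 LR.2).

(** A pair made of S0 and one of the two states is again admitted by the filter,
    so the Lipschitz bound on it gives convergence. A general pick covers not only
    the left and the right state but also the one where f is smaller or larger,
    as the squeeze of the logarithmic mean needs. *)
Lemma lipschitz_cvg (pick : state R * state R -> state R) f :
  (forall LR, pick LR = LR.1 \/ pick LR = LR.2) ->
  lipschitz f -> f (pick LR) @[LR --> F] --> f S0.
Proof.
move=> pickP /eqO_exP[C C0 [d d0 H]]; apply/cvgrPdist_lt => e e0.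
exists (Num.min d (e / C)); first by rewrite /= lt_min d0 divr_gt0.
move=> LR [hL hR].
have hp : ball (conserved gamma S0) (Num.min d (e / C)) (conserved gamma (pick LR)).
  by have [->|->] := pickP LR.
have hd : ball (conserved gamma S0) d (conserved gamma (pick LR)).
  by apply: le_ball hp; rewrite ge_min lexx.
rewrite distrC; apply: le_lt_trans (H (S0, pick LR) (conj (ballxx _ d0) hd)) _.
rewrite -ltr_pdivlMl// mulrC /jump /= distrC.
move: hp; rewrite -ball_normE /= => /lt_le_trans; apply.
by rewrite ge_min lexx orbT.
Qed.

Lemma lipschitz_cvg_left f : lipschitz f -> f LR.1 @[LR --> F] --> f S0.
Proof. by apply: lipschitz_cvg => LR; left. Qed.

Lemma lipschitz_cvg_right f : lipschitz f -> f LR.2 @[LR --> F] --> f S0.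
Proof. by apply: lipschitz_cvg => LR; right. Qed.

Lemma cvg_mul_bigO (c h : state R * state R -> R) (l : R) :
  c @ F --> l -> h =O_F dq -> (fun LR => c LR * h LR) =O_F dq.
Proof.
move=> cl /eqO_exP[C C0 H]; apply/eqO_exP; exists ((`|l| + 1) * C).
  by rewrite mulr_gt0// ltr_wpDl.
near=> LR; rewrite normrM -mulrA ler_pM//; last by near: LR.
by near: LR; apply: cvgr_norm_le cl _ _; rewrite ltrDl.
Unshelve. all: by end_near. Qed.

Lemma cvg0_mul_littleo (c h : state R * state R -> R) :
  c @ F --> 0 -> h =O_F dq -> (fun LR => c LR * h LR) =o_F dq.
Proof.
move=> cl /eqO_exP[C C0 H]; apply/eqoP => e e0.
near=> LR; rewrite normrM.
have -> : e * `|dq LR| = (e / C) * (C * `|dq LR|) by rewrite mulrA divfK ?gt_eqF.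
rewrite ler_pM//; last by near: LR.
by near: LR; apply: cvgr0_norm_le cl _ _; exact: divr_gt0.
Unshelve. all: by end_near. Qed.

Lemma lipschitz_add f g : lipschitz f -> lipschitz g -> lipschitz (fun S => f S + g S).
Proof.
move=> lf lg; rewrite /lipschitz.
rewrite (_ : (fun LR => _) =
   (fun LR => jump f LR.1 LR.2) + (fun LR => jump g LR.1 LR.2)).
  by rewrite lf lg addO.
by apply/funext => LR; rewrite /jump fctE opprD addrACA.
Qed.

Lemma lipschitz_const (k : R) : lipschitz (fun=> k).
Proof.
apply/eqO_exP; exists 1 => //.
by apply: filterE => LR; rewrite /jump subrr normr0 mulr_ge0.
Qed.

Lemma lipschitz_conserved i : lipschitz (fun S => conserved gamma S i 0).
Proof.
apply/eqO_exP; exists 1 => //; apply: filterE => LR; rewrite mul1r.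
apply: le_trans (le_coord_norm _ i 0) => /=.
by rewrite /jump !mxE.
Qed.

Lemma lipschitz_mul f g : lipschitz f -> lipschitz g -> lipschitz (fun S => f S * g S).
Proof.
move=> lf lg; rewrite /lipschitz.
rewrite (_ : (fun LR => _) =
   (fun LR => f LR.1 * jump g LR.1 LR.2) + (fun LR => g LR.2 * jump f LR.1 LR.2)).
  have h1 : (fun LR : state R * state R => f LR.1 * jump g LR.1 LR.2) =O_F dq.
    by apply: cvg_mul_bigO lg; apply: lipschitz_cvg_left.
  have h2 : (fun LR : state R * state R => g LR.2 * jump f LR.1 LR.2) =O_F dq.
    by apply: cvg_mul_bigO lf; apply: lipschitz_cvg_right.
  by rewrite h1 h2 addO.
by apply/funext => LR; rewrite /jump fctE; ring.
Qed.

Lemma lipschitz_inv f : (forall S, f S != 0) -> lipschitz f ->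
  lipschitz (fun S => (f S)^-1).
Proof.
move=> f0 lf; rewrite /lipschitz.
rewrite (_ : (fun LR => _) =
   (fun LR => - ((f LR.1)^-1 * (f LR.2)^-1) * jump f LR.1 LR.2)).
  apply: cvg_mul_bigO (lf).
    apply: cvgN; apply: cvgM; apply: cvgV => //.
      exact: lipschitz_cvg_left.
    exact: lipschitz_cvg_right.
by apply/funext => LR; rewrite /jump /=; field; rewrite !f0.
Qed.

Lemma lipschitz_rho : lipschitz (@rho R).
Proof.
rewrite (_ : @rho R = fun S => conserved gamma S (inord 0) 0); last first.
  by apply/funext => S; rewrite mxE inordK.
exact: lipschitz_conserved.
Qed.

Let rho0 S : rho S != 0. Proof. by rewrite gt_eqF ?rho_gt0. Qed.
Let p0 S : p S != 0. Proof. by rewrite gt_eqF ?p_gt0. Qed.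

Lemma lipschitz_div_rho i : lipschitz (fun S => conserved gamma S i 0 / rho S).
Proof.
by apply: lipschitz_mul; [exact: lipschitz_conserved|
   apply: lipschitz_inv => //; exact: lipschitz_rho].
Qed.

Lemma lipschitz_u : lipschitz (@u R).
Proof.
rewrite (_ : @u R = fun S => conserved gamma S (inord 1) 0 / rho S).
  exact: lipschitz_div_rho.
by apply/funext => S; rewrite mxE inordK//= mulrC mulKf.
Qed.

Lemma lipschitz_v : lipschitz (@v R).
Proof.
rewrite (_ : @v R = fun S => conserved gamma S (inord 2) 0 / rho S).
  exact: lipschitz_div_rho.
by apply/funext => S; rewrite mxE inordK//= mulrC mulKf.
Qed.

Lemma lipschitz_w : lipschitz (@w R).
Proof.
rewrite (_ : @w R = fun S => conserved gamma S (inord 3) 0 / rho S).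
  exact: lipschitz_div_rho.
by apply/funext => S; rewrite mxE inordK//= mulrC mulKf.
Qed.

(** The pressure is polynomial in the energy, the density, the velocity and the
    magnetic field. *)
Lemma lipschitz_p : lipschitz (@p R).
Proof.
pose c i S := conserved gamma S (inord i) 0.
rewrite (_ : @p R = fun S => (gamma - 1) * (c 4%N S
   + (- 2^-1) * (rho S * (u S * u S + v S * v S + w S * w S))
   + (- 2^-1) * (c 5%N S * c 5%N S + c 6%N S * c 6%N S + c 7%N S * c 7%N S))).
  repeat first [exact: lipschitz_conserved | exact: lipschitz_const
    | exact: lipschitz_u | exact: lipschitz_v | exact: lipschitz_w
    | exact: lipschitz_rho | apply: lipschitz_add | apply: lipschitz_mul].
apply/funext => S; rewrite /c !mxE !inordK//= /energy /normu2 /normB2.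
by field; rewrite (gamma_sub1_neq0 hgamma).
Qed.

Lemma lipschitz_beta : lipschitz (@beta R).
Proof.
apply: lipschitz_mul lipschitz_rho _; apply: lipschitz_inv => [S|].
  by rewrite mulf_neq0.
exact: lipschitz_mul (lipschitz_const _) lipschitz_p.
Qed.

Lemma lipschitz_jump_cvg0 f : lipschitz f -> jump f LR.1 LR.2 @[LR --> F] --> (0 : R).
Proof.
move=> lf; rewrite -(subrr (f S0)).
by apply: cvgB; [exact: lipschitz_cvg_right|exact: lipschitz_cvg_left].
Qed.

Lemma lipschitz_avg_cvg f : lipschitz f -> avg f LR.1 LR.2 @[LR --> F] --> f S0.
Proof.
move=> lf; rewrite -[f S0](mulKf (_ : 2 != 0))// mulr_natl mulr2n -div1r.
apply: cvgM; first exact: cvg_cst.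
by apply: cvgD; [exact: lipschitz_cvg_left|exact: lipschitz_cvg_right].
Qed.

Lemma lipschitz_logmean_cvg f : (forall S, 0 < f S) -> lipschitz f ->
  logmean f LR.1 LR.2 @[LR --> F] --> f S0.
Proof.
move=> f0 lf.
apply: (@squeeze_cvgr _ _ _ _ (fun LR => Num.min (f LR.1) (f LR.2))
  (fun LR => Num.max (f LR.1) (f LR.2))).
- by apply: filterE => LR; exact: logmean_between.
- under eq_fun do rewrite /Num.min -(fun_if f).
  by apply: lipschitz_cvg lf => LR; case: ifP; [left|right].
- under eq_fun do rewrite /Num.max -(fun_if f).
  by apply: lipschitz_cvg lf => LR; case: ifP; [right|left].
Qed.

Let beta_neq0 S : beta S != 0. Proof. by rewrite gt_eqF ?beta_gt0. Qed.

Lemma lipschitz_inv_beta : lipschitz (fun S => (2 * beta S)^-1).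
Proof.
apply: lipschitz_inv => [S|]; first by rewrite mulf_neq0.
exact: lipschitz_mul (lipschitz_const _) lipschitz_beta.
Qed.

(** * The energy component *)

Lemma defect_rho_cvg0 : defect_rho (gamma := gamma) LR @[LR --> F] --> (0 : R).
Proof.
rewrite [X in _ --> X](_ : 0 =
  (gamma - 1)^-1 * ((2 * beta S0)^-1 - (2 * beta S0)^-1)
  + 4^-1 * (0 ^+ 2 + 0 ^+ 2 + 0 ^+ 2)); last first.
  by rewrite subrr !expr0n /= !addr0 !mulr0 addr0.
apply: cvgD; apply: cvgM; try exact: cvg_cst.
  apply: cvgB; first exact: lipschitz_avg_cvg lipschitz_inv_beta.
  apply: cvgV; first by rewrite mulf_neq0.
  apply: cvgM; first exact: cvg_cst.
  exact: lipschitz_logmean_cvg beta_gt0 lipschitz_beta.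
apply: cvgD; first apply: cvgD.
- by apply: cvgM; apply: lipschitz_jump_cvg0 lipschitz_u.
- by apply: cvgM; apply: lipschitz_jump_cvg0 lipschitz_v.
- by apply: cvgM; apply: lipschitz_jump_cvg0 lipschitz_w.
Qed.

Lemma defect_beta_cvg0 : defect_beta (gamma := gamma) LR @[LR --> F] --> (0 : R).
Proof.
rewrite [X in _ --> X](_ : 0 =
  (gamma - 1)^-1 * (rho S0 / (2 * (beta S0 * beta S0))
                    - rho S0 / (2 * (beta S0 * beta S0)))); last by rewrite subrr mulr0.
apply: cvgM; first exact: cvg_cst.
apply: cvgB; apply: cvgM.
- exact: (lipschitz_logmean_cvg _ (@rho_gt0 R) lipschitz_rho).
- apply: cvgV; first by rewrite mulf_neq0 ?(mulf_neq0 (beta_neq0 S0)).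
  apply: cvgM; first exact: cvg_cst.
  by apply: cvgM; apply: lipschitz_logmean_cvg beta_gt0 lipschitz_beta.
- exact: lipschitz_avg_cvg lipschitz_rho.
- apply: cvgV; first by rewrite mulf_neq0 ?(mulf_neq0 (beta_neq0 S0)).
  apply: cvgM; first exact: cvg_cst.
  apply: cvgM; first exact: lipschitz_cvg_left lipschitz_beta.
  exact: lipschitz_cvg_right lipschitz_beta.
Qed.

Lemma energy_defect_littleo :
  (fun LR : state R * state R =>
     jump (conserved gamma) LR.1 LR.2 energy_index 0
     - (H_hat gamma LR.1 LR.2 *m jump (entropy_vars gamma) LR.1 LR.2)
         energy_index 0)
  =o_ (tends_to_common gamma S0)
    (fun LR : state R * state R => jump (conserved gamma) LR.1 LR.2).
Proof.
rewrite (_ : (fun LR => _) =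
  (fun LR => defect_rho (gamma := gamma) LR * jump (@rho R) LR.1 LR.2)
  + (fun LR => defect_beta (gamma := gamma) LR * jump (@beta R) LR.1 LR.2)).
  have := cvg0_mul_littleo _ _ defect_rho_cvg0 lipschitz_rho => ->.
  have := cvg0_mul_littleo _ _ defect_beta_cvg0 lipschitz_beta => ->.
  exact: addo.
by apply/funext => -[L Rt]; rewrite (energy_defect hgamma).
Qed.

End Lipschitz.

Theorem theorem3 (R : realType) (gamma : R) (hgamma : 1 < gamma) :
  (forall (L Rt : state R) (i : 'I_8), i != energy_index ->
     jump (conserved gamma) L Rt i 0 =
     (H_hat gamma L Rt *m jump (entropy_vars gamma) L Rt) i 0) /\
  (forall S0 : state R,
     (fun LR : state R * state R =>
        jump (conserved gamma) LR.1 LR.2 energy_index 0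
        - (H_hat gamma LR.1 LR.2 *m jump (entropy_vars gamma) LR.1 LR.2)
            energy_index 0)
     =o_ (tends_to_common gamma S0)
       (fun LR : state R * state R => jump (conserved gamma) LR.1 LR.2)).
Proof.
split=> [L Rt i|S0]; first exact: jump_conserved_exact.
exact: energy_defect_littleo.
Qed.
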